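(* Let $\mathbb{X}$ be either $L_p[0,1]$ with $1\le p\le\infty$, or $\mathbb X=C[0,1]$, or $\mathbb X=D[0,1]$. Let $k\in\mathbb N$ and $\bm\alpha=(\alpha_x)_{x\in[0,1]}$ with $\alpha_x\in(0,1)$ for every $x\in[0,1]$. The point-wise component-wise quantile $\mathbf q_{P,\bm\alpha}$ exists, is unique, and is Lipschitz continuous. In particular, for all $\mathbf f_1,\dots,\mathbf f_k,\mathbf g_1,\dots,\mathbf g_k\in\mathbb X$: if $\mathbb X=L_p[0,1]$ with $1\le p<\infty$, then $$\|\mathbf q_{P,\bm\alpha}(\mathbf f_1,\dots,\mathbf f_k)-\mathbf q_{P,\bm\alpha}(\mathbf g_1,\dots,\mathbf g_k)\|_{\mathbb X}\le\bigg(\sum_{i=1}^k\int_0^1|\mathbf f_i(x)-\mathbf g_i(x)|^p\,dx\bigg)^{1/p}\le\|(\mathbf f_1,\dots,\mathbf f_k)-(\mathbf g_1,\dots,\mathbf g_k)\|_{\mathbb X^k};$$ if $\mathbb X=L_\infty[0,1]$ or $\mathbb X=C[0,1]$ or $\mathbb X=D[0,1]$, then $$\|\mathbf q_{P,\bm\alpha}(\mathbf f_1,\dots,\mathbf f_k)-\mathbf q_{P,\bm\alpha}(\mathbf g_1,\dots,\mathbf g_k)\|_{\mathbb X}\le\max_{i=1,\dots,k}\|\mathbf f_i-\mathbf g_i\|_{\mathbb X}\le\|(\mathbf f_1,\dots,\mathbf f_k)-(\mathbf g_1,\dots,\mathbf g_k)\|_{\mathbb X^k}.$$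
   Context: Univariate quantile: for $\alpha\in(0,1)$ and $\mathbf x\in\mathbb R^k$ with increasingly ordered components $\tilde x_1\le\dots\le\tilde x_k$, $q_\alpha(\mathbf x)=\frac12(\tilde x_{\lceil k\alpha\rceil}+\tilde x_{\lfloor k\alpha+1\rfloor})$. Point-wise component-wise quantile: for $\mathbf f_1,\dots,\mathbf f_k\in\mathbb X$ and $x\in[0,1]$, $\mathbf q_{P,\bm\alpha}(\mathbf f_1,\dots,\mathbf f_k)(x)=q_{\alpha_x}(\mathbf f_1(x),\dots,\mathbf f_k(x))$; its existence means that this defines an element of $\mathbb X$. $C[0,1]$ (continuous functions) and $D[0,1]$ (c\`adl\`ag functions) are endowed with the supremum norm. The norm on $\mathbb X^k$ is $\|(\mathbf f_1,\dots,\mathbf f_k)\|_{\mathbb X^k}=\sum_{i=1}^k\|\mathbf f_i\|_{\mathbb X}$.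
   Formalization: Existence fails for arbitrary α_x; it is proved when the ranks x↦⌈kα_x⌉ and x↦⌊kα_x+1⌋ belong to X (also necessary). Uniqueness, Lipschitz continuity and the bounds hold for any α_x in (0,1), for f, g whose quantiles exist. *)

(* Defs.v *)
From HB Require Import structures.
From mathcomp Require Import all_boot all_order all_algebra.
From mathcomp Require Import all_classical all_reals all_analysis.

Set Implicit Arguments.
Unset Strict Implicit.
Unset Printing Implicit Defensive.
Import Order.TTheory GRing.Theory Num.Theory.
Import numFieldNormedType.Exports.

Local Open Scope classical_set_scope.
Local Open Scope ring_scope.

Section quantile.
Context {R : realType}.

(** Ranks are 1-based; both lie in {1, ..., k} when 0 < a < 1 and 0 < k. *)
Definition rank_lo (k : nat) (a : R) : nat := `|Num.ceil (k%:R * a)|%N.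
Definition rank_hi (k : nat) (a : R) : nat := `|Num.floor (k%:R * a + 1)|%N.

Definition quantile (k : nat) (a : R) (x : 'I_k -> R) : R :=
  let s := sort <=%R [seq x i | i : 'I_k] in
  (s`_(rank_lo k a).-1 + s`_(rank_hi k a).-1) / 2.

End quantile.

Section function_spaces.
Context {R : realType}.

Definition unit_itv : set R := [set` `[0 : R, 1]].

(** Its L_p spaces are those of [0,1]: functions on [R] are identified as soon
    as they agree almost everywhere on [0,1]. *)
Definition leb01 : {measure set (measurableTypeR R) -> \bar R} :=
  mrestr (@lebesgue_measure R) (measurable_itv `[0 : R, 1]).

(** The one-sided filters are degenerate at the endpoints, so that there is no
    condition on the left of 0 or on the right of 1. *)
Definition cadlag (f : unit_itv -> R) : Prop :=
  forall x : unit_itv,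
    (f y @[y --> within [set y : unit_itv | val x < val y] (nbhs x)] --> f x) /\
    (exists l : R,
      f y @[y --> within [set y : unit_itv | val y < val x] (nbhs x)] --> l).

Inductive fspace : Type :=
  | Lspace01 (p : \bar R) of (1 <= p)%E
  | C01
  | D01.

(** [Lspace01 p] consists of classes modulo almost everywhere equality. *)
Definition elt (X : fspace) : Type :=
  match X with
  | Lspace01 p p1 => LspaceType leb01 p1
  | C01 => {f : unit_itv -> R | continuous f}
  | D01 => {f : unit_itv -> R | cadlag f}
  end.

Definition dom (X : fspace) : Type :=
  match X with
  | Lspace01 _ _ => R
  | C01 | D01 => unit_itv
  end.

Definition pt (X : fspace) : dom X -> R :=
  match X with
  | Lspace01 _ _ => fun x => x
  | C01 | D01 => fun x => val x
  end.

Definition ev (X : fspace) : elt X -> dom X -> R :=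
  match X with
  | Lspace01 _ p1 => fun f => (f : LspaceType leb01 p1)
  | C01 | D01 => fun f => proj1_sig f
  end.

Definition represents (X : fspace) : elt X -> (dom X -> R) -> Prop :=
  match X with
  | Lspace01 _ p1 => fun f F =>
      ((f : LspaceType leb01 p1) : R -> R) = F %[ae leb01]
  | C01 | D01 => fun f F => proj1_sig f = F
  end.

Definition sup_norm (f : unit_itv -> R) : \bar R :=
  ereal_sup [set `|f x|%:E | x in [set: unit_itv]].

Definition fnorm (X : fspace) : (dom X -> R) -> \bar R :=
  match X with
  | Lspace01 p _ => fun f => Lnorm leb01 p (fun x => (f x)%:E)
  | C01 | D01 => sup_norm
  end.

(** The norm of u - v. *)
Definition normB (X : fspace) (u v : elt X) : \bar R :=
  fnorm (fun x : dom X => ev u x - ev v x).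

Definition normB_prod (X : fspace) (k : nat) (f g : 'I_k -> elt X) : \bar R :=
  (\sum_(i < k) normB (f i) (g i))%E.

(** The spaces whose norm is a supremum. *)
Definition is_sup_space (X : fspace) : Prop :=
  match X with
  | Lspace01 p _ => p = +oo%E
  | C01 | D01 => True
  end.

Definition pointwise_quantile (X : fspace) (k : nat) (alpha : R -> R)
    (F : 'I_k -> dom X -> R) : dom X -> R :=
  fun x => quantile (alpha (pt x)) (fun i => F i x).

(** [q] is the quantile of the [f i]: in L_p, whatever functions are chosen to
    represent the classes [f i], their point-wise quantile represents [q]. *)
Definition is_pquantile (X : fspace) (k : nat) (alpha : R -> R)
    (f : 'I_k -> elt X) (q : elt X) : Prop :=
  forall F : 'I_k -> dom X -> R,
    (forall i, represents (f i) (F i)) ->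
    represents q (pointwise_quantile alpha F).

(** The ranks used at x, as functions of x, are elements of [X]. The quantile
    need not exist without such a condition: in C[0,1], for k = 2,
    alpha = 1/4 on [0,1/2[ and alpha = 3/4 on [1/2,1], the quantile of the
    constant functions 0 and 1 is the indicator function of [1/2,1]. *)
Definition ranks_in (X : fspace) (k : nat) (alpha : R -> R) : Prop :=
  (exists u : elt X, represents u (fun x => (rank_lo k (alpha (pt x)))%:R)) /\
  (exists u : elt X, represents u (fun x => (rank_hi k (alpha (pt x)))%:R)).

End function_spaces.

Arguments fspace : clear implicits.

(* Main.v *)
Require Import Defs.
From HB Require Import structures.
From mathcomp Require Import all_boot all_order all_algebra.
From mathcomp Require Import all_classical all_reals all_analysis.
From mathcomp Require Import measurable_realfun ess_sup_inf.
From mathcomp Require Import lra.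
Import Order.TTheory GRing.Theory Num.Theory.
Import numFieldNormedType.Exports.
Local Open Scope classical_set_scope.
Local Open Scope ring_scope.

(** Everything rests on one fact about finite samples: an order statistic is at
    most [t] exactly when sufficiently many entries are at most [t]
    ([order_stat_le]). Raising every entry by at most [d] therefore raises each
    order statistic by at most [d], so order statistics, and the quantiles that
    average two of them, are 1-Lipschitz for the maximum norm
    ([quantile_lipschitz]). As the index set is finite and nonempty, the
    distance between two quantiles of the same level is bounded by the distance
    between the entries at some single index ([quantile_dist_witness]).

    The bounds follow by applying this at (almost) every point x. In a supremum
    norm they are immediate. In L_p with p finite, the p-th power of one term is
    at most the sum of the p-th powers of all of them, and integration gives the
    first inequality; the second is the subadditivity of t |-> t ^ (1/p)
    ([poweR_sum_le]). Each chain bounds the distance between the quantiles by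
    the norm on the product space, so 1 is a Lipschitz constant throughout.

    Existence needs the two rank functions to behave well. In C and D they have
    limits along the relevant filters and integer values, hence are eventually
    constant there; the pointwise quantile then eventually averages two fixed
    order statistics, which are continuous ([quantile_cvg]). In L_p the ranks
    agree almost everywhere with measurable functions, the order statistics of
    measurable functions are measurable ([measurable_order_stat]), and the
    result is dominated by the sum of the absolute values of the functions. *)

(** * Order statistics and quantiles of a finite sample *)

Section order_statistics.
Context {R : realType} {k : nat}.
Implicit Types (x y : 'I_k -> R) (i : 'I_k) (j : nat) (d t : R).

(** Ranks start at 1 and the index [j] at 0, whence the predecessors below. *)
Definition order_stat j x : R := (sort <=%R [seq x i | i : 'I_k])`_j.

Lemma quantileE (a : R) x :
  quantile a x =
  (order_stat (rank_lo k a).-1 x + order_stat (rank_hi k a).-1 x) / 2.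
Proof. by []. Qed.

Lemma order_stat_default j x : (k <= j)%N -> order_stat j x = 0.
Proof.
move=> kj; rewrite /order_stat nth_default//.
by rewrite size_sort size_map size_enum_ord.
Qed.

(** In a sorted list the entries that are at most [t] form an initial segment,
    so counting them decides on which side of [t] the entry at [j] falls. *)
Lemma order_stat_le j x t : (j < k)%N ->
  (order_stat j x <= t) = (j < #|[pred i | (x i <= t)%R]|)%N.
Proof.
move=> jk; rewrite /order_stat; set s := sort _ _.
have ss : sorted <=%R s by exact: sort_le_sorted.
have -> : #|[pred i | (x i <= t)%R]| = count (fun z => z <= t) s.
  rewrite count_sort count_map cardE size_filter -enumT.
  by apply: eq_count => i; rewrite !inE.
have szs : size s = k by rewrite size_sort size_map size_enum_ord.
case: ltnP => jc; first exact: nth_count_le.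
by apply/negbTE; rewrite -ltNge nth_count_gt// jc szs.
Qed.

(** More than [j] entries of [x] are at most [order_stat j x], and at the same
    indices [y] is at most [order_stat j x + d]. *)
Lemma order_stat_shift j x y d : (j < k)%N ->
  (forall i, y i <= x i + d) -> order_stat j y <= order_stat j x + d.
Proof.
move=> jk yx; rewrite order_stat_le//.
have := lexx (order_stat j x); rewrite {1}order_stat_le// => /leq_trans; apply.
apply/subset_leq_card/fintype.subsetP => i; rewrite !inE => xi.
by rewrite (le_trans (yx i))// lerD2r.
Qed.

Lemma order_stat_lipschitz j x y d : 0 <= d ->
  (forall i, `|x i - y i| <= d) -> `|order_stat j x - order_stat j y| <= d.
Proof.
move=> d0 xy; have [kj|jk] := leqP k j.
  by rewrite !order_stat_default// subrr normr0.
rewrite ler_norml lerBrDl addrC -lerBrDl opprK lerBlDl.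
by apply/andP; split; apply: order_stat_shift => // i;
   have /[!ler_norml]/andP[] := xy i; lra.
Qed.

Lemma quantile_lipschitz (a : R) x y d : 0 <= d ->
  (forall i, `|x i - y i| <= d) -> `|quantile a x - quantile a y| <= d.
Proof.
move=> d0 xy; rewrite !quantileE -mulrBl normrM.
have := order_stat_lipschitz (rank_lo k a).-1 x y d d0 xy.
have := order_stat_lipschitz (rank_hi k a).-1 x y d d0 xy.
rewrite [`|2^-1|]gtr0_norm// ler_pdivrMr// !ler_norml => /andP[? ?] /andP[? ?].
by apply/andP; split; lra.
Qed.

Lemma order_stat0 j : order_stat j (fun=> 0) = 0.
Proof.
have [kj|jk] := leqP k j; first exact: order_stat_default.
have : order_stat j (fun=> 0) \in codom (fun _ : 'I_k => 0 : R).
  by rewrite -(mem_sort <=%R) mem_nth// size_sort size_map size_enum_ord.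
by case/mapP.
Qed.

Lemma order_stat_norm_le j x : `|order_stat j x| <= \sum_i `|x i|.
Proof.
rewrite -[order_stat j x]subr0 -{1}(order_stat0 j).
apply: order_stat_lipschitz => [|i].
  by apply: sumr_ge0.
by rewrite subr0 (bigD1 i)//= lerDl sumr_ge0.
Qed.

(** The index is one at which the two samples are farthest apart. This form
    gives the bounds for sums of powers as well as those for maxima. *)
Lemma quantile_dist_witness (a : R) x y : (0 < k)%N ->
  exists i, `|quantile a x - quantile a y| <= `|x i - y i|.
Proof.
move=> k0; exists [arg max_(i > Ordinal k0) `|x i - y i|]%O.
case: arg_maxP => //= i _ imax.
by apply: quantile_lipschitz => // i'; exact: imax.
Qed.

End order_statistics.

(** * Limits of quantiles *)

Section convergence.
Context {R : realType} {k : nat} {T : Type} (F : set_system T) {FF : Filter F}.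

Lemma order_stat_cvg (f : 'I_k -> T -> R) (l : 'I_k -> R) j :
  (forall i, f i x @[x --> F] --> l i) ->
  order_stat j (f^~ x) @[x --> F] --> order_stat j l.
Proof.
move=> fl; apply/cvgrPdist_le => e e0.
have : \forall x \near F, forall i, `|l i - f i x| <= e.
  apply: filter_forall => i.
  exact: (cvgr_dist_le _ _ (fl i)).
by apply: filterS => x xe; apply: order_stat_lipschitz => //; exact: ltW.
Qed.

(** The level [a] itself need not converge: only the ranks that it determines
    matter. *)
Lemma quantile_cvg (a : T -> R) (f : 'I_k -> T -> R) (l : 'I_k -> R) m n :
  (forall i, f i x @[x --> F] --> l i) ->
  (\forall x \near F, rank_lo k (a x) = m) ->
  (\forall x \near F, rank_hi k (a x) = n) ->
  quantile (a x) (f^~ x) @[x --> F] -->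
    (order_stat m.-1 l + order_stat n.-1 l) / 2.
Proof.
move=> fl lom hin.
apply: (@cvg_trans _
  ((order_stat m.-1 (f^~ x) + order_stat n.-1 (f^~ x)) / 2 @[x --> F])).
  apply: near_eq_cvg; apply: filterS2 lom hin => x lo hi.
  by rewrite quantileE lo hi.
by apply: cvgMl; apply: cvgD; exact: order_stat_cvg.
Qed.

(** Near the limit, two values of [u] differ by less than 1. The filter may be
    degenerate, as it is for the left limit at 0, and then any [n] will do. *)
Lemma cvg_natr_near_cst (u : T -> nat) (c : R) :
  (u x)%:R @[x --> F] --> c -> exists n, \forall x \near F, u x = n.
Proof.
move/cvgrPdist_lt => /(_ 2^-1 ltac:(by [])) uc.
have [[x0 x0c]|noX] := pselect (exists x0, `|c - (u x0)%:R| < 2^-1); last first.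
  exists 0%N; apply: filterS uc => x xc; exfalso; apply: noX; by exists x.
exists (u x0); apply: filterS uc => x xc.
apply/eqP; move: xc x0c; rewrite !ltr_norml => /andP[? ?] /andP[? ?].
rewrite eqn_leq -[(_ <= u x0)%N]ltnS -[(_ <= u x)%N]ltnS.
by rewrite -!(ltr_nat R) -!natr1; apply/andP; split; lra.
Qed.

Lemma cvg_natr_near_eq (u : T -> nat) (n : nat) :
  (u x)%:R @[x --> F] --> (n%:R : R) -> \forall x \near F, u x = n.
Proof.
move/cvgrPdist_lt => /(_ 1 ltr01); apply: filterS => x.
rewrite ltr_norml => /andP[? ?]; apply/eqP.
rewrite eqn_leq -[(_ <= n)%N]ltnS -[(_ <= u x)%N]ltnS.
by rewrite -!(ltr_nat R) -!natr1; apply/andP; split; lra.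
Qed.

End convergence.

(** * Measurability of order statistics *)

Section measurability.
Context {R : realType} {k : nat} {d : measure_display} {T : measurableType d}.

(** By [order_stat_le], a sublevel set of an order statistic is a finite union,
    over the large sets of indices, of finite intersections of sublevel sets. *)
Lemma measurable_order_stat (f : 'I_k -> T -> R) j :
  (forall i, measurable_fun setT (f i)) ->
  measurable_fun setT (fun x => order_stat j (f^~ x)).
Proof.
move=> mf; have [kj|jk] := leqP k j.
  by under eq_fun do rewrite order_stat_default//; exact: measurable_cst.
move=> _; apply: (measurability _ (RGenOInfty.measurableE R)) => //.
move=> /= _ [_ [t ->] <-]; rewrite setTI -setCitvl preimage_setC.
apply: measurableC.
rewrite [X in measurable X](_ : _ =
  \bigcup_(S in [set S : {set 'I_k} | (j < #|S|)%N])
    \bigcap_(i in [set` S]) [set x | f i x <= t]); last first.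
  apply/seteqP; split => [x /=|x [S /= jS Sx]];
    rewrite in_itv/= order_stat_le//.
    move=> jx; exists (finset [pred i | (f i x <= t)%R]).
      by rewrite /= cardsE.
    by move=> i /=; rewrite inE.
  apply: (leq_trans jS); apply/subset_leq_card/fintype.subsetP => i iS.
  by rewrite inE; exact: Sx.
apply: fin_bigcup_measurable => // S _.
apply: fin_bigcap_measurable => // i _.
have := mf i measurableT `]-oo, t]%classic (measurable_itv _).
by rewrite setTI; congr measurable; apply/seteqP; split => x /=; rewrite in_itv.
Qed.

(** It lets the rank of an order statistic depend on the point. *)
Lemma measurable_fun_select (r : T -> nat) (f : nat -> T -> R) :
  measurable_fun setT r -> (forall n, measurable_fun setT (f n)) ->
  measurable_fun setT (fun x => f (r x) x).
Proof.
move=> mr mf _ Y mY; rewrite setTI.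
rewrite [X in measurable X](_ : _ =
  \bigcup_n (r @^-1` [set n] `&` f n @^-1` Y)).
  apply: bigcupT_measurable => n; apply: measurableI.
    by rewrite -[X in measurable X]setTI; exact: mr.
  by rewrite -[X in measurable X]setTI; exact: mf.
apply/seteqP; split => x /=; first by exists (r x).
by move=> [n _ [/= ->]].
Qed.

(** It turns a representative of a rank function, which takes integer values
    only almost everywhere, into a function with values in [nat]. *)
Lemma measurable_truncn_norm (u : T -> R) : measurable_fun setT u ->
  measurable_fun setT (fun x => Num.truncn `|u x|).
Proof.
move=> mu _; have mn : measurable_fun setT (fun x => `|u x|).
  exact: measurableT_comp.
move=> Y _; rewrite setTI.
rewrite [X in measurable X](_ : _ =
  \bigcup_(n in Y) (fun x => `|u x|) @^-1` `[n%:R, n.+1%:R[).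
  apply: bigcup_measurable => n _.
  by rewrite -[X in measurable X]setTI; exact: mn.
apply/seteqP; split => x /=.
  move=> Yx; exists (Num.truncn `|u x|) => //=.
  by rewrite in_itv/= truncn_itv.
by move=> [n Yn /=]; rewrite in_itv/= -truncn_eq// => /eqP ->.
Qed.

End measurability.

(** * Subadditivity of concave powers *)

Section power.
Context {R : realType}.

(** With s = a + b, the numbers a / s and b / s lie in [0, 1] and add up to 1.
    Such numbers do not exceed their q-th powers; multiply by s ^ q. *)
Lemma powR_subadditive (a b q : R) : 0 <= a -> 0 <= b -> 0 < q <= 1 ->
  (a + b) `^ q <= a `^ q + b `^ q.
Proof.
move=> a0 b0 /andP[q0 q1].
have [s0|s0] := eqVneq (a + b) 0.
  by rewrite s0 powR0 ?gt_eqF// addr_ge0// powR_ge0.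
have {s0} sgt0 : 0 < a + b by rewrite lt0r s0 addr_ge0.
have le_pow (c : R) : 0 <= c <= a + b -> c / (a + b) <= (c / (a + b)) `^ q.
  move=> /andP[c0 cs]; have [->|c'] := eqVneq c 0.
    by rewrite mul0r powR_ge0.
  have cgt0 : 0 < c by rewrite lt0r c' c0.
  by apply: ger1_powR => //; rewrite divr_gt0//= ler_pdivrMr// mul1r.
have pow_split (c : R) : 0 <= c -> c `^ q = (c / (a + b)) `^ q * (a + b) `^ q.
  by move=> c0; rewrite -powRM ?divfK ?gt_eqF// ?divr_ge0// ltW.
rewrite (pow_split a)// (pow_split b)// -mulrDl ler_peMl ?powR_ge0//.
apply: le_trans (lerD (le_pow a _) (le_pow b _)).
- by rewrite -mulrDl divff// gt_eqF.
- by rewrite a0 lerDl.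
- by rewrite b0 lerDr.
Qed.

Local Open Scope ereal_scope.

Lemma poweR_subadditive (a b : \bar R) (q : R) : 0 <= a -> 0 <= b ->
  (0 < q <= 1)%R -> (a + b) `^ q <= a `^ q + b `^ q.
Proof.
move=> a0 b0 q01; have q0 : (q != 0)%R by case/andP: q01 => /gt_eqF ->.
move: a b a0 b0 => [a| |] [b| |]// a0 b0.
by rewrite -EFinD !poweR_EFin -EFinD lee_fin powR_subadditive.
all: by rewrite /= (negbTE q0) leey.
Qed.

Lemma poweR_sum_le {I : Type} (s : seq I) (a : I -> \bar R) (q : R) :
  (forall i, 0 <= a i) -> (0 < q <= 1)%R ->
  (\sum_(i <- s) a i) `^ q <= \sum_(i <- s) a i `^ q.
Proof.
move=> a0 q01; elim: s => [|i s ih].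
  by rewrite !big_nil poweR0r//; case/andP: q01 => /gt_eqF ->.
rewrite !big_cons (le_trans (poweR_subadditive _ _ _ _ _ _))//.
  exact: sume_ge0.
by rewrite leeD2l.
Qed.

End power.

(** * Monotonicity and subadditivity of L_p norms *)

Section Lnorm.
Context {R : realType} {d : measure_display} {T : measurableType d}.
Variable mu : {measure set T -> \bar R}.
Local Open Scope ereal_scope.

Lemma ae_le_Lnorm (p : \bar R) (f g : T -> R) : 1 <= p ->
  measurable_fun setT f -> measurable_fun setT g ->
  (\forall x \ae mu, (`|f x| <= `|g x|)%R) ->
  'N[mu]_p[EFin \o f] <= 'N[mu]_p[EFin \o g].
Proof.
move=> p1 mf mg fg; rewrite unlock.
have mpow (h : T -> R) r : measurable_fun setT h ->
    measurable_fun setT (fun x => `|(EFin \o h) x| `^ r).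
  move=> mh; apply/measurable_EFinP.
  apply: (@measurableT_comp _ _ _ _ _ _ (@powR R ^~ r)) => //.
  exact: measurableT_comp.
case: p p1 => [r r1| _|//].
- have r0 : (0 <= r)%R by rewrite -lee_fin (le_trans lee01).
  apply: gt0_ler_poweR; rewrite ?invr_ge0//.
  + by rewrite in_itv/= leey integral_ge0// => x _; exact: poweR_ge0.
  + by rewrite in_itv/= leey integral_ge0// => x _; exact: poweR_ge0.
  + apply: ae_ge0_le_integral => //.
    * by move=> x _; exact: poweR_ge0.
    * exact: mpow.
    * by move=> x _; exact: poweR_ge0.
    * exact: mpow.
    apply: filterS fg => x fgx _; rewrite /= lee_fin.
    by apply: ge0_ler_powR; rewrite // nnegrE.
- case: ifPn => // _; apply: le_ess_sup.
  by apply: filterS fg => x fgx /=; rewrite lee_fin.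
Qed.

Lemma Lnorm_sum_le (p : \bar R) {I : Type} (s : seq I) (f : I -> T -> R) :
  1 <= p -> (forall i, measurable_fun setT (f i)) ->
  'N[mu]_p[EFin \o (fun x => \sum_(i <- s) f i x)%R] <=
  \sum_(i <- s) 'N[mu]_p[EFin \o f i].
Proof.
move=> p1 mf; elim: s => [|i s ih].
  rewrite big_nil (_ : _ \o _ = cst 0).
    by rewrite Lnorm0// gt_eqF// (lt_le_trans _ p1).
  by apply/funext => x /=; rewrite big_nil.
rewrite big_cons (_ : _ \o _ =
    EFin \o (f i \+ (fun x => \sum_(j <- s) f j x))%R); last first.
  by apply/funext => x /=; rewrite big_cons.
rewrite (le_trans (eminkowski _ _ _ _))//.
  exact: measurable_sum.
by rewrite leeD2l.
Qed.

End Lnorm.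

(** * Classes of functions on the unit interval *)

Section unit_interval_measure.
Context {R : realType}.
Local Open Scope ereal_scope.

Lemma ge0_integral_leb01 (f : measurableTypeR R -> \bar R) :
  measurable_fun setT f -> (forall x, 0 <= f x) ->
  \int[leb01]_x f x = \int[@lebesgue_measure R]_(x in `[0%R, 1%R]) f x.
Proof.
move=> mf f0; rewrite (@ge0_negligible_integral _ (measurableTypeR R) R leb01
  setT (~` [set` `[0%R : R, 1%R]]))//.
- rewrite setTD setCK; apply: eq_measure_integral => A mA A01.
  by rewrite /leb01/= /mrestr setIidl.
- by apply: measurableC; exact: measurable_itv.
- by rewrite /leb01/= /mrestr setICl measure0.
Qed.

End unit_interval_measure.

#[local] Instance leb01_ae_filter {R : realType} :
  Filter (nbhs (almost_everywhere (@leb01 R))).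
Proof. exact: ae_filter_ringOfSetsType. Qed.

Section Lspace.
Context {R : realType} (p : \bar R) (p1 : (1 <= p)%E).
Local Notation Lp := (Lspace01 p1).
Local Notation L0 := {mfun_ leb01, measurableTypeR R >-> measurableTypeR R}.
Local Open Scope quotient_scope.

Lemma Lspace_measurable (f : elt Lp) :
  measurable_fun [set: measurableTypeR R] (@ev R Lp f).
Proof. exact: (measurable_funPT (repr ((f : LspaceType leb01 p1) : L0))). Qed.

(** A class carries the finiteness of the norm of its canonical representative,
    which need not be [Q]; the two norms agree since they do not distinguish
    functions equal almost everywhere. *)
Lemma Lspace_class (Q : measurableTypeR R -> measurableTypeR R) :
  measurable_fun setT Q -> finite_norm leb01 p Q ->
  exists q : elt Lp, @represents R Lp q Q.
Proof.
move=> mQ nQ.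
pose Qm : {mfun measurableTypeR R >-> measurableTypeR R} :=
  HB.pack Q (isMeasurableFun.Build _ _ _ _ Q mQ).
pose q0 : L0 := \pi Qm.
have q0Q : (q0 : R -> R) = Q %[ae leb01].
  have : repr q0 = Qm %[mod L0].
    by rewrite reprK.
  by move/eqmodP/asboolP.
have nq0 : finite_norm leb01 p (q0 : R -> R).
  apply: le_lt_trans nQ; apply: ae_le_Lnorm => //.
    exact: (measurable_funPT (repr q0)).
  by apply: filterS q0Q => x /(_ Logic.I) ->.
pose q : LspaceType leb01 p1 :=
  HB.pack q0 (isFinLebesgue.Build _ _ _ _ _ p1 q0 nq0).
by exists q.
Qed.

Lemma Lspace_eq (q q' : elt Lp) (F : R -> R) :
  @represents R Lp q F -> @represents R Lp q' F -> q = q'.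
Proof.
move=> qF q'F.
have qq' : (q : R -> R) = (q' : R -> R) %[ae leb01].
  by apply: filterS2 qF q'F => x /= h h' _; rewrite h// h'.
have : (q : L0) = q'.
  rewrite -[LHS]reprK -[RHS]reprK; apply/eqmodP/asboolP; exact: qq'.
case: q q' {qF q'F qq'} => [q [[nq]]] [q' [[nq']]] /= qq'.
by subst q'; rewrite (Prop_irrelevance nq nq').
Qed.

Lemma Lspace_finite_norm (f : elt Lp) : finite_norm leb01 p (@ev R Lp f).
Proof. exact: (@Lebesgue_finite _ _ _ _ _ p1 (f : LspaceType leb01 p1)). Qed.

(** Arbitrary representatives of the [f i] and of the ranks agree almost
    everywhere with the ones chosen to build the quantile [Q], simultaneously
    since there are finitely many of them. *)
Lemma Lspace_pquantile_exists (k : nat) (alpha : R -> R) :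
  ranks_in Lp k alpha ->
  forall f : 'I_k -> elt Lp, exists q : elt Lp, is_pquantile alpha f q.
Proof.
move=> [[u ulo] [v vhi]] f.
(* Representatives of the ranks are integers almost everywhere only;
   truncation makes them so everywhere, and fixes the integers. *)
pose lo (x : measurableTypeR R) := Num.truncn `|@ev R Lp u x|.
pose hi (x : measurableTypeR R) := Num.truncn `|@ev R Lp v x|.
pose F x i := @ev R Lp (f i) x.
pose Q (x : measurableTypeR R) : measurableTypeR R :=
  (order_stat (lo x).-1 (F x) + order_stat (hi x).-1 (F x)) / 2.
have mQ : measurable_fun setT Q.
  have mstat (w : elt Lp) : measurable_fun [set: measurableTypeR R]
      (fun x => order_stat (Num.truncn `|@ev R Lp w x|).-1 (F x)).
    apply: (@measurable_fun_select R _ _ (fun x => Num.truncn `|@ev R Lp w x|)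
      (fun n x => order_stat n.-1 (F x))).
      by apply: measurable_truncn_norm; exact: Lspace_measurable.
    by move=> n; apply: measurable_order_stat => i; exact: Lspace_measurable.
  by apply: measurable_funM => //; apply: measurable_funD; exact: mstat.
have mabs i : measurable_fun [set: measurableTypeR R] (fun x => `|F x i|).
  by apply: measurableT_comp => //; exact: Lspace_measurable.
have nQ : finite_norm leb01 p Q.
  (* The bound holds even where a truncated rank exceeds [k]: the default value
     0 of the order statistic satisfies it. *)
  have QF : ('N[leb01]_p[EFin \o Q] <=
      \sum_(i < k)
        'N[leb01]_p[EFin \o (fun x : measurableTypeR R => `|F x i|%R)])%E.
    apply: le_trans (Lnorm_sum_le _ _ _ _ _ _) => //.
    apply: ae_le_Lnorm => //; first exact: measurable_sum.
    apply: aeW => x; rewrite [leRHS]ger0_norm ?sumr_ge0//.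
    rewrite /Q normrM [`|2^-1|]gtr0_norm// ler_pdivrMr// mulr_natr mulr2n.
    by rewrite (le_trans (ler_normD _ _))// lerD// order_stat_norm_le.
  apply: (le_lt_trans QF); apply: lte_sum_pinfty => i _.
  apply: le_lt_trans (Lspace_finite_norm (f i)).
  apply: ae_le_Lnorm => //; first exact: Lspace_measurable.
  by apply: aeW => x; rewrite normr_id.
have [q qQ] := Lspace_class _ mQ nQ.
exists q => G fG.
have fGx : \forall x \ae leb01, forall i, F x i = G i x.
  apply: filter_forall => i.
  by apply: filterS (fG i) => x /(_ Logic.I).
have {}ulo : \forall x \ae leb01, lo x = rank_lo k (alpha x).
  apply: filterS ulo => x /(_ Logic.I); rewrite /lo /ev => ->.
  by rewrite normr_nat natrK.
have {}vhi : \forall x \ae leb01, hi x = rank_hi k (alpha x).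
  apply: filterS vhi => x /(_ Logic.I); rewrite /hi /ev => ->.
  by rewrite normr_nat natrK.
apply: filterS2 (filterI ulo vhi) (filterI qQ fGx) => x [lox hix] [qx Fx] _.
rewrite qx// /Q lox hix /pointwise_quantile quantileE.
by rewrite (_ : (fun i => G i x) = F x)//; apply/funext => i; rewrite -Fx.
Qed.

Lemma Lspace_pquantile_dist (k : nat) (alpha : R -> R)
    (f g : 'I_k -> elt Lp) (qf qg : elt Lp) : (0 < k)%N ->
  is_pquantile alpha f qf -> is_pquantile alpha g qg ->
  \forall x \ae leb01, exists i,
    `|@ev R Lp qf x - @ev R Lp qg x| <= `|@ev R Lp (f i) x - @ev R Lp (g i) x|.
Proof.
move=> k0 fq gq.
have {}fq := fq (fun i => ev (f i)) (fun i => ae_eq_refl _ _ _).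
have {}gq := gq (fun i => ev (g i)) (fun i => ae_eq_refl _ _ _).
apply: filterS2 fq gq => x /(_ Logic.I) fqx /(_ Logic.I) gqx.
by rewrite /= fqx gqx; exact: quantile_dist_witness.
Qed.

End Lspace.

(** * Existence in C and D, and suprema *)

Section sup_spaces.
Context {R : realType} (k : nat) (alpha : R -> R).

(** Continuous rank functions are locally constant. *)
Lemma C01_pquantile_exists : ranks_in (C01 : fspace R) k alpha ->
  forall f : 'I_k -> elt C01, exists q : elt C01, is_pquantile alpha f q.
Proof.
move=> [[[u cu] /= uE] [[v cv] /= vE]] f.
have cQ : continuous (@pointwise_quantile R C01 k alpha (fun i => sval (f i))).
  move=> x; apply: (@quantile_cvg R k _ _ (nbhs_filter x)
    (fun y => alpha (val y)) (fun i => sval (f i)) (fun i => sval (f i) x)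
    (rank_lo k (alpha (val x))) (rank_hi k (alpha (val x)))) => [i||].
  - exact: (svalP (f i)).
  - apply: (@cvg_natr_near_eq R _ _ (nbhs_filter x)).
    by have := cu x; rewrite uE.
  - apply: (@cvg_natr_near_eq R _ _ (nbhs_filter x)).
    by have := cv x; rewrite vE.
exists (exist _ _ cQ) => F fF /=.
by rewrite (_ : F = fun i => sval (f i))//; apply/funext => i; rewrite -(fF i).
Qed.

(** From the right the ranks are eventually equal to their values at the point.
    From the left they are eventually equal to some constants, which are
    then the ranks of the order statistics that give the left limit. *)
Lemma D01_pquantile_exists : ranks_in (D01 : fspace R) k alpha ->
  forall f : 'I_k -> elt D01, exists q : elt D01, is_pquantile alpha f q.
Proof.
move=> [[[u cu] /= uE] [[v cv] /= vE]] f.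
have cQ : cadlag (@pointwise_quantile R D01 k alpha (fun i => sval (f i))).
  move=> x.
  pose right := within [set y : unit_itv | val x < val y] (nbhs x).
  pose left := within [set y : unit_itv | val y < val x] (nbhs x).
  have right_filter : Filter right by exact: within_filter.
  have left_filter : Filter left by exact: within_filter.
  split.
    apply: (@quantile_cvg R k _ _ right_filter (fun y => alpha (val y))
      (fun i => sval (f i)) (fun i => sval (f i) x)
      (rank_lo k (alpha (val x))) (rank_hi k (alpha (val x)))) => [i||].
    - by have [] := svalP (f i) x.
    - apply: (@cvg_natr_near_eq R _ _ right_filter).
      by have [] := cu x; rewrite uE.
    - apply: (@cvg_natr_near_eq R _ _ right_filter).
      by have [] := cv x; rewrite vE.
  have /choice[l fl] : forall i, exists l : R,
      sval (f i) y @[y --> left] --> l.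
    by move=> i; have [] := svalP (f i) x.
  have [_ [lu]] := cu x; rewrite uE.
  move=> /(@cvg_natr_near_cst R _ _ left_filter) [m um].
  have [_ [lv]] := cv x; rewrite vE.
  move=> /(@cvg_natr_near_cst R _ _ left_filter) [n vn].
  exists ((order_stat m.-1 l + order_stat n.-1 l) / 2).
  exact: (@quantile_cvg R k _ _ left_filter (fun y => alpha (val y))
    (fun i => sval (f i))).
exists (exist _ _ cQ) => F fF /=.
by rewrite (_ : F = fun i => sval (f i))//; apply/funext => i; rewrite -(fF i).
Qed.

Lemma sup_norm_quantile_dist (f g : 'I_k -> unit_itv -> R) : (0 < k)%N ->
  (sup_norm (fun x : unit_itv =>
      quantile (alpha (val x)) (f^~ x) - quantile (alpha (val x)) (g^~ x))%R <=
    \big[maxe/0]_(i < k) sup_norm (fun x => f i x - g i x)%R)%E.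
Proof.
move=> k0; apply: ge_ereal_sup => _ [x _ <-].
have [i qi] := quantile_dist_witness (alpha (val x)) (f^~ x) (g^~ x) k0.
apply: le_trans (le_bigmax _ _ i).
apply: (@le_trans _ _ `|f i x - g i x|%:E); first by rewrite lee_fin.
by apply: ereal_sup_ubound; exists x.
Qed.

End sup_spaces.

(** * Uniqueness and bounds *)

Section bounds.
Context {R : realType}.
Local Open Scope ereal_scope.

Lemma normB_ge0 (X : fspace R) (u v : elt X) : 0 <= normB u v.
Proof.
case: X u v => [p p1||] u v; first exact: Lnorm_ge0.
all: have x01 : (0%R : R) \in unit_itv
  by rewrite inE /unit_itv/= in_itv/= lexx ler01.
all: apply: le_trans (ereal_sup_ubound _); last by exists (SigSub x01).
all: by rewrite lee_fin.
Qed.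

Lemma bigmaxe_le_sum (I : finType) (a : I -> \bar R) : (forall i, 0 <= a i) ->
  \big[maxe/0]_i a i <= \sum_i a i.
Proof.
move=> a0; apply: bigmax_le => [|i _]; first exact: sume_ge0.
by rewrite (bigD1 i)//= leeDl// sume_ge0.
Qed.

(** The functions [ev (f i)] are representatives of the [f i], so both elements
    are represented by one and the same function. *)
Lemma pquantile_unique (X : fspace R) (k : nat) (alpha : R -> R)
    (f : 'I_k -> elt X) (q q' : elt X) :
  is_pquantile alpha f q -> is_pquantile alpha f q' -> q = q'.
Proof.
move=> fq fq'.
have fF i : represents (f i) (ev (f i)).
  by case: X f q q' fq fq' => [p p1||] f q q' _ _ //; exact: ae_eq_refl.
move: (fq _ fF) (fq' _ fF).
case: X f q q' {fq fq' fF} => [p p1||] f q q'; first exact: Lspace_eq.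
all: move=> qF q'F; apply: eq_sig_hprop; last exact: (etrans qF (esym q'F)).
all: by move=> h u v; exact: Prop_irrelevance.
Qed.

(** In L_infinity the differences of the [f i] and [g i] stay below their
    essential suprema off a common null set. *)
Lemma sup_space_bound (X : fspace R) (k : nat) (alpha : R -> R)
    (f g : 'I_k -> elt X) (qf qg : elt X) : (0 < k)%N -> is_sup_space X ->
  is_pquantile alpha f qf -> is_pquantile alpha g qg ->
  normB qf qg <= \big[maxe/0]_(i < k) normB (f i) (g i).
Proof.
move=> k0; case: X f g qf qg => [p p1||] f g qf qg; last 2 first.
- move=> _ /(_ (fun i => ev (f i)) (fun=> erefl)) /= fq.
  move=> /(_ (fun i => ev (g i)) (fun=> erefl)) /= gq.
  by rewrite /normB /= fq gq; exact: sup_norm_quantile_dist.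
- move=> _ /(_ (fun i => ev (f i)) (fun=> erefl)) /= fq.
  move=> /(_ (fun i => ev (g i)) (fun=> erefl)) /= gq.
  by rewrite /normB /= fq gq; exact: sup_norm_quantile_dist.
move=> /= poo; subst p => fq gq.
have := Lspace_pquantile_dist _ _ _ _ _ _ _ _ k0 fq gq.
rewrite /normB /= unlock; case: ifPn => mu0 dist; last first.
  exact: bigmax_ge_id.
apply/ess_supP.
pose h i x := `|@ev R (Lspace01 p1) (f i) x - @ev R (Lspace01 p1) (g i) x|%:E.
have : \forall x \ae leb01, forall i, h i x <= ess_sup leb01 (h i).
  by apply: filter_forall => i; exact: ess_sup_ge.
apply: filterS2 dist => x [i qi] fgx.
apply: le_trans (le_bigmax _ _ i).
by apply: le_trans (fgx i); rewrite lee_fin.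
Qed.

Lemma Lspace_bound (p : R) (p1 : 1 <= p%:E) (k : nat) (alpha : R -> R)
    (f g : 'I_k -> elt (Lspace01 p1)) (qf qg : elt (Lspace01 p1)) :
  (0 < k)%N -> is_pquantile alpha f qf -> is_pquantile alpha g qg ->
  let M := (\sum_(i < k) \int[@lebesgue_measure R]_(x in `[0%R, 1%R])
      ((`|@ev R (Lspace01 p1) (f i) x - @ev R (Lspace01 p1) (g i) x|
         `^ p)%R)%:E) `^ p^-1%R in
  normB qf qg <= M /\ M <= normB_prod f g.
Proof.
move=> k0 fq gq M.
have p_ge1 : (1 <= p)%R by rewrite -lee_fin.
have p_gt0 : (0 < p)%R by exact: lt_le_trans p_ge1.
have mpow (u v : elt (Lspace01 p1)) : measurable_fun [set: measurableTypeR R]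
    (fun x => ((`|@ev R (Lspace01 p1) u x - @ev R (Lspace01 p1) v x|
                  `^ p)%R)%:E).
  apply/measurable_EFinP.
  apply: (@measurableT_comp _ _ _ _ _ _ (@powR R ^~ p)) => //.
  apply: measurableT_comp => //.
  by apply: measurable_funB; exact: Lspace_measurable.
(* [I u v] is the p-th power of the L_p norm of u - v. *)
pose I (u v : elt (Lspace01 p1)) := \int[@lebesgue_measure R]_(x in `[0%R, 1%R])
  ((`|@ev R (Lspace01 p1) u x - @ev R (Lspace01 p1) v x| `^ p)%R)%:E.
have I_ge0 u v : 0 <= I u v.
  by apply: integral_ge0 => x _; rewrite lee_fin powR_ge0.
have IE u v : I u v = \int[leb01]_x
    ((`|@ev R (Lspace01 p1) u x - @ev R (Lspace01 p1) v x| `^ p)%R)%:E.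
  by rewrite ge0_integral_leb01// => x; rewrite lee_fin powR_ge0.
have normE u v : normB u v = I u v `^ p^-1.
  by rewrite IE /normB /= unlock.
have qI : I qf qg <= \sum_(i < k) I (f i) (g i).
  under eq_bigr do rewrite IE.
  rewrite IE -ge0_integral_sum//.
  apply: ae_ge0_le_integral => //.
  - by move=> x _; apply: sume_ge0 => i _; rewrite lee_fin powR_ge0.
  - exact: emeasurable_sum.
  apply: filterS (Lspace_pquantile_dist _ _ _ _ _ _ _ _ k0 fq gq) => x [i qi] _.
  rewrite (bigD1 i)//= -[leLHS]adde0; apply: leeD.
    by rewrite lee_fin; apply: ge0_ler_powR; rewrite ?nnegrE// ltW.
  by apply: sume_ge0 => j _; rewrite lee_fin powR_ge0.
split.
  rewrite normE; apply: gt0_ler_poweR => //.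
  - by rewrite invr_ge0 ltW.
  - by rewrite in_itv/= leey I_ge0.
  - by rewrite in_itv/= leey sume_ge0// => i _; exact: I_ge0.
rewrite /normB_prod; under eq_bigr do rewrite normE.
apply: poweR_sum_le => [i|]; first exact: I_ge0.
by rewrite invr_gt0 p_gt0 invf_le1.
Qed.

End bounds.

Theorem theorem4p5 (R : realType) (k : nat) (hk : (0 < k)%N)
    (alpha : R -> R)
    (halpha : forall x : R, 0 <= x <= 1 -> 0 < alpha x < 1) :
  (* existence, uniqueness and Lipschitz continuity *)
  (forall X : fspace R,
     [/\ ranks_in X k alpha ->
           forall f : 'I_k -> elt X, exists q : elt X, is_pquantile alpha f q,
         forall (f : 'I_k -> elt X) (q q' : elt X),
           is_pquantile alpha f q -> is_pquantile alpha f q' -> q = q' &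
         exists L : R, 0 <= L /\
           forall (f g : 'I_k -> elt X) (qf qg : elt X),
             is_pquantile alpha f qf -> is_pquantile alpha g qg ->
             (normB qf qg <= L%:E * normB_prod f g)%E]) /\
  (* the bounds in L_p, p finite *)
  (forall (p : R) (p1 : (1 <= p%:E)%E)
      (f g : 'I_k -> elt (Lspace01 p1)) (qf qg : elt (Lspace01 p1)),
     is_pquantile alpha f qf -> is_pquantile alpha g qg ->
     let M : \bar R :=
       ((\sum_(i < k) \int[@lebesgue_measure R]_(x in `[0%R, 1%R])
           ((`|@ev R (Lspace01 p1) (f i) x - @ev R (Lspace01 p1) (g i) x|
              `^ p)%R)%:E) `^ p^-1%R)%E in
     (normB qf qg <= M)%E /\ (M <= normB_prod f g)%E) /\
  (* the bounds in L_infinity, C and D *)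
  (forall (X : fspace R), is_sup_space X ->
     forall (f g : 'I_k -> elt X) (qf qg : elt X),
     is_pquantile alpha f qf -> is_pquantile alpha g qg ->
     let M : \bar R := (\big[maxe/0]_(i < k) normB (f i) (g i))%E in
     (normB qf qg <= M)%E /\ (M <= normB_prod f g)%E).
Proof.
have sup_bounds (X : fspace R) (f g : 'I_k -> elt X) (qf qg : elt X) :
    is_sup_space X -> is_pquantile alpha f qf -> is_pquantile alpha g qg ->
    (normB qf qg <= \big[maxe/0]_(i < k) normB (f i) (g i) <= normB_prod f g)%E.
  move=> supX fq gq; rewrite (sup_space_bound _ _ _ _ _ _ _ _ supX fq gq)//.
  by apply: bigmaxe_le_sum => i; exact: normB_ge0.
split; [move=> X; split|split].
- case: X => [p p1||].
  + exact: Lspace_pquantile_exists.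
  + exact: C01_pquantile_exists.
  + exact: D01_pquantile_exists.
- exact: pquantile_unique.
- exists 1; split=> // f g qf qg fq gq; rewrite mul1e.
  case: X f g qf qg fq gq => [[r||] p1||] f g qf qg fq gq //.
  + have [h1 h2] := Lspace_bound _ _ _ _ _ _ _ _ hk fq gq.
    exact: le_trans h2.
  + have /andP[h1 h2] := sup_bounds (Lspace01 p1) f g qf qg erefl fq gq.
    exact: le_trans h2.
  + have /andP[h1 h2] := sup_bounds C01 f g qf qg Logic.I fq gq.
    exact: le_trans h2.
  + have /andP[h1 h2] := sup_bounds D01 f g qf qg Logic.I fq gq.
    exact: le_trans h2.
- by move=> p p1 f g qf qg; exact: Lspace_bound.
- by move=> X supX f g qf qg fq gq M; apply/andP; exact: sup_bounds.
Qed.
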